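(* Let $\varepsilon \in (0,1)$, $n_1, n_2 \in \mathbb{N}$, and $r = \lceil 9 \log(3 n_1 n_2)/\varepsilon^2 \rceil$. Let $m \in \mathbb{N}$ and let $W \in \mathbb{R}^{m \times m}$ be symmetric positive-definite. Let $R > 0$, let $\{x_i\}_{i=1}^{n_1}, \{y_j\}_{j=1}^{n_2} \subset \overline{\mathbb{B}}_{m,R}$, and define $D \in \mathbb{R}^{n_1 \times n_2}$ by $D(i,j) = \|x_i - y_j\|_W^2$. Let $\Omega = [\min\{D\}, \max\{D\}]$ and let $h : \Omega \to \mathbb{R}$ be a bounded function in $C^\infty(\Omega)$ such that, for some constants $C \geq 0$ and $M > 0$, $\|h^{(s)}\|_{L_\infty(\Omega)} \leq C M^s$ for all $s \in \mathbb{N}_0$. Then for every $t \in \mathbb{N}$ with $t \geq e^2 M (\max\{D\} - \min\{D\})/2$, there exists $G \in \mathbb{R}^{n_1 \times n_2}$ with $\mathrm{rank}(G) \leq 1 + (t-1) r$ such that $$\|h(D) - G\|_{\max} \leq C \left[ e^{-t} + \varepsilon \left( e^{8 M \|W\|_2 R^2} - 1 \right) \right].$$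
   Context: $\mathbb{N} = \{1,2,\ldots\}$ and $\mathbb{N}_0 = \{0,1,2,\ldots\}$; $\log$ is the natural logarithm and $e$ is Euler's number. $\min\{D\}$ and $\max\{D\}$ are the smallest and largest entries of $D$; $h(D)$ denotes the entrywise application of $h$. $\|F\|_{\max} = \max_{i,j} |F(i,j)|$; $\|W\|_2$ is the spectral norm; $\|x\|_W = \sqrt{x^\top W x}$; $\overline{\mathbb{B}}_{m,R} = \{x \in \mathbb{R}^m : \|x\|_2 \leq R\}$. For a function $g$ on $\Omega$, $\|g\|_{L_\infty(\Omega)} = \sup_{x \in \Omega} |g(x)|$, and $h^{(s)}$ is the $s$-th derivative of $h$. *)

(* Defs.v *)
From HB Require Import structures.
From mathcomp Require Import all_boot all_order all_algebra.
From mathcomp Require Import all_classical all_reals all_analysis.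
Set Implicit Arguments.
Unset Strict Implicit.
Unset Printing Implicit Defensive.
Import Order.TTheory GRing.Theory Num.Theory.
Import numFieldNormedType.Exports.
Local Open Scope classical_set_scope.
Local Open Scope ring_scope.

(* The library norm `|x| on column vectors and matrices is the entrywise
   maximum ||.||_max, so the Euclidean, weighted and spectral norms are
   introduced here. *)

Definition norm2 (R : realType) (m : nat) (x : 'cV[R]_m) : R :=
  Num.sqrt (\sum_i x i 0 ^+ 2).

Definition wnorm (R : realType) (m : nat) (W : 'M[R]_m) (x : 'cV[R]_m) : R :=
  Num.sqrt ((x^T *m W *m x) 0 0).

Definition spectral_norm (R : realType) (m n : nat) (W : 'M[R]_(m, n)) : R :=
  sup [set norm2 (W *m x) | x in [set x : 'cV[R]_n | norm2 x <= 1]].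

Definition sym_posdef (R : realType) (m : nat) (W : 'M[R]_m) : Prop :=
  W^T = W /\ forall x : 'cV[R]_m, x != 0 -> 0 < (x^T *m W *m x) 0 0.

(* The default values used below (0 on an empty matrix) are irrelevant as soon
   as both dimensions are positive, see [min_entryP] and [max_entryP]. *)

Definition entries (R : realType) (m n : nat) (D : 'M[R]_(m, n)) : seq R :=
  [seq D ij.1 ij.2 | ij : 'I_m * 'I_n].

Definition min_entry (R : realType) (m n : nat) (D : 'M[R]_(m, n)) : R :=
  \big[Num.min/head 0 (entries D)]_(d <- entries D) d.

Definition max_entry (R : realType) (m n : nat) (D : 'M[R]_(m, n)) : R :=
  \big[Num.max/head 0 (entries D)]_(d <- entries D) d.

Lemma mem_entries (R : realType) (m n : nat) (D : 'M[R]_(m, n)) i j :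
  D i j \in entries D.
Proof. by apply/fintype.imageP; exists (i, j). Qed.

Lemma entriesP (R : realType) (m n : nat) (D : 'M[R]_(m, n)) d :
  d \in entries D -> exists i j, d = D i j.
Proof. by case/fintype.imageP => -[i j] _ ->; exists i, j. Qed.

Lemma head_entries (R : realType) (m n : nat) (D : 'M[R]_(m, n)) :
  (0 < m)%N -> (0 < n)%N -> head 0 (entries D) \in entries D.
Proof.
move=> m0 n0; have := mem_entries D (Ordinal m0) (Ordinal n0).
by case: (entries D) => //= d s _; rewrite mem_head.
Qed.

Lemma min_entryP (R : realType) (m n : nat) (D : 'M[R]_(m, n)) :
  (0 < m)%N -> (0 < n)%N ->
  (exists i j, min_entry D = D i j) /\ (forall i j, min_entry D <= D i j).
Proof.
move=> m0 n0; split; last first.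
  by move=> i j; apply: (@ge_bigmin_seq _ _ _ _ _ (D i j) xpredT id (mem_entries D i j)).
apply: entriesP; rewrite /min_entry big_seq.
apply: (big_ind (fun d => d \in entries D)) => //; first exact: head_entries.
by move=> a b aD bD; case: (leP a b).
Qed.

Lemma max_entryP (R : realType) (m n : nat) (D : 'M[R]_(m, n)) :
  (0 < m)%N -> (0 < n)%N ->
  (exists i j, max_entry D = D i j) /\ (forall i j, D i j <= max_entry D).
Proof.
move=> m0 n0; split; last first.
  by move=> i j; apply: (@le_bigmax_seq _ _ _ _ _ (D i j) xpredT id (mem_entries D i j)).
apply: entriesP; rewrite /max_entry big_seq.
apply: (big_ind (fun d => d \in entries D)) => //; first exact: head_entries.
by move=> a b aD bD; case: (leP a b).
Qed.

(* A function on A is represented by a total function f : R -> R of which only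
   the values on A matter. Difference quotients are restricted to A, so that on
   a closed interval the derivative is two-sided inside and one-sided at the
   endpoints. At an isolated point of A (in particular when A is a singleton)
   the derivative is 0 by convention. *)

Definition diff_quot (R : realType) (f : R -> R) (x : R) : R -> R :=
  fun y => (f y - f x) / (y - x).

Definition derive_on (R : realType) (A : set R) (f : R -> R) : R -> R :=
  fun x => if `[< limit_point A x >]
           then lim (diff_quot f x @ within A x^') else 0.

Definition derive_onn (R : realType) (A : set R) (s : nat) (f : R -> R) :
  R -> R := iter s (derive_on A) f.

Definition smooth_on (R : realType) (A : set R) (f : R -> R) : Prop :=
  forall (s : nat) (x : R), A x -> limit_point A x ->
    cvg (diff_quot (derive_onn A s f) x @ within A x^').

(* Extended-real valued, so that an unbounded function has norm +oo. *)
Definition sup_norm (R : realType) (A : set R) (g : R -> R) : \bar R :=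
  ereal_sup [set (`|g x|)%:E | x in A].

(* Main.v *)
(* Taylor's formula at the midpoint c of Omega gives a polynomial of degree
   t - 1 in D - c, up to C e^-t.  The matrix D - c factors as <u_i, v_j> with
   |u_i|^2, |v_j|^2 <= 6 |W|_2 R^2, hence its s-th entrywise power factors
   through the s-th tensor powers, with the constant raised to the power s.
   Such a matrix is approximated entrywise by a matrix of rank r by projecting
   the factors on r random sign vectors (Johnson-Lindenstrauss); the entries of
   the sketch are bilinear Rademacher chaoses, whose exponential moments are
   controlled by adding the signs one at a time. *)
Require Import Defs.
From HB Require Import structures.
From mathcomp Require Import all_boot all_order all_algebra.
From mathcomp Require Import all_classical all_reals all_analysis.
From mathcomp Require Import ring lra.
Set Implicit Arguments.
Unset Strict Implicit.
Unset Printing Implicit Defensive.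
Import Order.TTheory GRing.Theory Num.Theory.
Import numFieldNormedType.Exports.
Local Open Scope classical_set_scope.
Local Open Scope ring_scope.

(** * Exponential moments under averaging over signs *)

Lemma ge0_derive_le0x (R : realType) (f df : R -> R) (x : R) :
  (forall v : R, is_derive v 1 f (df v)) -> (forall v : R, 0 <= v -> 0 <= df v) ->
  0 <= x -> f 0 <= f x.
Proof.
move=> fdf df0 x0.
have fc : {within `[0, x], continuous f}.
  apply: continuous_subspaceT => v.
  exact/differentiable_continuous/derivable1_diffP/(@ex_derive _ _ _ _ _ _ _ (fdf v)).
have [c] := MVT_segment x0 (fun v _ => fdf v) fc.
rewrite in_itv/= => /andP[c0 _]; rewrite subr0 => e.
by rewrite -subr_ge0 e mulr_ge0// df0.
Qed.

(** Subgaussian bound for a single sign. For [x >= 0] the function [cosh x * exp (- x^2 / 2)]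
    decreases from its value 1 at 0: its derivative has the sign of [- psi], where [psi 0 = 0] and
    [psi' v = 2 * v * sinh v >= 0]. *)
Lemma cosh_le_expR (R : realType) (x : R) :
  (expR x + expR (- x)) / 2 <= expR (x ^+ 2 / 2).
Proof.
wlog x0 : x / 0 <= x.
  move=> H; have [/H//|/ltW x0] := leP 0 x.
  by rewrite -sqrrN addrC -{2}(opprK x); apply: H; rewrite oppr_ge0.
pose psi (v : R) := (1 + v) * expR (- v) - (1 - v) * expR v.
have psi0 v : 0 <= v -> 0 <= psi v.
  move=> v0.
  suff : psi 0 <= psi v by rewrite /psi oppr0 expR0; lra.
  apply: (@ge0_derive_le0x R psi (fun v => v * (expR v - expR (- v)))) => //.
    move=> u; apply: is_derive_eq; rewrite /GRing.scale/=; ring.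
  by move=> u u0; rewrite mulr_ge0// subr_ge0 ler_expR; lra.
pose g (v : R) := - (expR (v - v ^+ 2 / 2) + expR (- v - v ^+ 2 / 2)).
have : g 0 <= g x.
  apply: (@ge0_derive_le0x R g (fun v => psi v * expR (- (v ^+ 2 / 2)))) => //.
    move=> u; apply: is_derive_eq; rewrite /GRing.scale/= /psi !expRD; by field.
  by move=> u u0; apply: mulr_ge0; [exact: psi0|exact: expR_ge0].
rewrite /g expr0n/= mul0r oppr0 addr0 expR0 !expRD expRN.
have := expR_gt0 (x ^+ 2 / 2); set E := expR (x ^+ 2 / 2) => E0.
rewrite -mulrDl => h.
have : (expR x + expR (- x)) / E <= 2 by lra.
by rewrite ler_pdivrMr//; lra.
Qed.

(** Expectation over independent uniform signs [q i] in {-1, 1}. The recursion on the first sign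
    replaces any probability space and matches inductions that add one sign at a time. For [n = 0]
    there is only one vector, written [fun=> 0]. *)
Fixpoint sign_avg (R : realType) (n : nat) : (('I_n -> R) -> R) -> R :=
  match n with
  | 0 => fun f => f (fun=> 0)
  | n'.+1 => fun f =>
      let ext (e : R) (q : 'I_n' -> R) (i : 'I_n'.+1) :=
        if unlift ord0 i is Some j then q j else e in
      (sign_avg (fun q => f (ext 1 q)) + sign_avg (fun q => f (ext (-1) q))) / 2
  end.

(** First-moment method: some value lies below the mean. This turns averages into explicit choices
    in [greedy_signs]. *)
Lemma sign_avg_le (R : realType) (n : nat) (f : ('I_n -> R) -> R) :
  exists q, f q <= sign_avg f.
Proof.
elim: n f => [|n IH] f /=; first by exists (fun=> 0).
set f1 := fun q => f _; set f2 := fun q => f _.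
have [q1 h1] := IH f1; have [q2 h2] := IH f2.
have [le12|/ltW le21] := leP (f1 q1) (f2 q2).
(* The witness is found by unification: [f1 q1] unfolds to [f] at [q1] extended by a first sign. *)
- by eexists; apply: (le_trans (y := f1 q1)); [exact: lexx|lra].
- by eexists; apply: (le_trans (y := f2 q2)); [exact: lexx|lra].
Qed.

Lemma eq_sign_avg (R : realType) (n : nat) (f g : ('I_n -> R) -> R) :
  f =1 g -> sign_avg f = sign_avg g.
Proof. by move=> fg; congr sign_avg; apply/funext. Qed.

Lemma sign_avg0 (R : realType) (n : nat) :
  sign_avg (fun _ : 'I_n -> R => 0) = 0.
Proof. by elim: n => //= n ->; rewrite addr0 mul0r. Qed.

Lemma sign_avgD (R : realType) (n : nat) (f g : ('I_n -> R) -> R) :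
  sign_avg (fun q => f q + g q) = sign_avg f + sign_avg g.
Proof. by elim: n f g => //= n IH f g; rewrite !IH; lra. Qed.

Lemma sign_avgZ (R : realType) (n : nat) (c : R) (f : ('I_n -> R) -> R) :
  sign_avg (fun q => c * f q) = c * sign_avg f.
Proof. by elim: n f => //= n IH f; rewrite !IH; lra. Qed.

Lemma sign_avg_sum (R : realType) (n : nat) (I : Type) (s : seq I)
    (f : I -> ('I_n -> R) -> R) :
  sign_avg (fun q => \sum_(i <- s) f i q) = \sum_(i <- s) sign_avg (f i).
Proof.
elim: s => [|i s IH].
  by rewrite big_nil -[RHS](sign_avg0 R n); apply: eq_sign_avg => q; rewrite big_nil.
rewrite big_cons -IH -sign_avgD; apply: eq_sign_avg => q.
by rewrite big_cons.
Qed.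

(* The quadratic form in the exponent is kept, up to the part carried by
   [l * s * t], below a multiple of the identity; adding a sign of weight
   (a, b) costs at most [a ^+ 2 + b ^+ 2] on [L]. *)
Lemma sign_avg_expR_bilin (R : realType) (n : nat) (a b : 'I_n -> R)
    (s t l L : R) :
  let S := \sum_i (a i ^+ 2 + b i ^+ 2) in
  S < L -> `|l| <= L^-1 ->
  sign_avg (fun q => let X := s + \sum_i q i * a i in
                     let Y := t + \sum_i q i * b i in
     expR (l * (X * Y) + (L^-1 - `|l|) / 2 * (X ^+ 2 + Y ^+ 2)))
  <= expR (l * (s * t + \sum_i a i * b i)
           + ((L - S)^-1 - `|l|) / 2 * (s ^+ 2 + t ^+ 2 + S)).
Proof.
elim: n a b s t => [|n IH] a b s t /=.
  by move=> _ _; rewrite !big_ord0 !subr0 !addr0.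
rewrite !big_ord_recl/=.
set a0 := a ord0; set b0 := b ord0.
set A := \sum_i (a (lift ord0 i) ^+ 2 + _).
set P := \sum_i (a (lift ord0 i) * _).
move=> SL lL.
have A0 : 0 <= A by apply: sumr_ge0 => i _; rewrite addr_ge0 ?sqr_ge0.
have a0b0 : 0 <= a0 ^+ 2 + b0 ^+ 2 by rewrite addr_ge0 ?sqr_ge0.
have L1 : A < L by lra.
set w := (L - A)^-1.
have w0 : 0 < w by rewrite invr_gt0 subr_gt0.
have lw : `|l| <= w.
  apply: (le_trans lL); rewrite lef_pV2 ?posrE ?subr_gt0 //; lra.
(* Once the first sign is fixed to [e], it only shifts the starting points [s] and [t], so the
   induction hypothesis applies to the other signs. *)
have step e : sign_avg (fun q : 'I_n -> R =>
     let X := s + \sum_(i < n.+1) (if unlift ord0 i is Some j then q j else e) * a i in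
     let Y := t + \sum_(i < n.+1) (if unlift ord0 i is Some j then q j else e) * b i in
     expR (l * (X * Y) + (L^-1 - `|l|) / 2 * (X ^+ 2 + Y ^+ 2)))
   <= expR (l * ((s + e * a0) * (t + e * b0) + P)
      + (w - `|l|) / 2 * ((s + e * a0) ^+ 2 + (t + e * b0) ^+ 2 + A)).
  apply: le_trans (IH (a \o lift ord0) (b \o lift ord0) _ _ L1 lL).
  rewrite le_eqVlt; apply/orP; left; apply/eqP/eq_sign_avg => q /=.
  have E c : \sum_(i < n.+1) (if unlift ord0 i is Some j then q j else e) * c i
      = e * c ord0 + \sum_i q i * c (lift ord0 i).
    by rewrite big_ord_recl unlift_none; congr (_ + _); apply: eq_bigr => i _; rewrite liftK.
  by rewrite !E !addrA.
have := step 1; have := step (-1) => /= h1 h2.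
(* [Q] and [u] are the even and odd parts in [e] of the exponent in [step], so the average over [e]
   is [exp Q * cosh u]. *)
set u := l * (s * b0 + t * a0) + (w - `|l|) * (s * a0 + t * b0).
set Q := l * (s * t + a0 * b0 + P)
      + (w - `|l|) / 2 * (s ^+ 2 + t ^+ 2 + (a0 ^+ 2 + b0 ^+ 2 + A)).
set w' := (L - (a0 ^+ 2 + b0 ^+ 2 + A))^-1.
apply: (@le_trans _ _ (expR Q * expR (u ^+ 2 / 2))).
  apply: (@le_trans _ _ (expR Q * ((expR u + expR (- u)) / 2))); last first.
    by rewrite ler_wpM2l ?expR_ge0 ?cosh_le_expR.
  rewrite mulrA mulrDr -!expRD.
  have h3 : Q + u = l * ((s + 1 * a0) * (t + 1 * b0) + P)
      + (w - `|l|) / 2 * ((s + 1 * a0) ^+ 2 + (t + 1 * b0) ^+ 2 + A).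
    by rewrite /Q /u; field.
  have h4 : Q - u = l * ((s + -1 * a0) * (t + -1 * b0) + P)
      + (w - `|l|) / 2 * ((s + -1 * a0) ^+ 2 + (t + -1 * b0) ^+ 2 + A).
    by rewrite /Q /u; field.
  rewrite ler_pM2r ?invr_gt0// h3 h4; exact: lerD.
rewrite -expRD ler_expR.
(* Tangent line bound for the convex map [1 / (L - A - d)] at [d = 0], taken at
   [d = a0^2 + b0^2]. *)
have ww' : w * (1 + w * (a0 ^+ 2 + b0 ^+ 2)) <= w'.
  have w'0 : 0 < w' by rewrite invr_gt0 subr_gt0.
  have e1 : w^-1 = L - A by rewrite invrK.
  have e2 : w'^-1 = L - (a0 ^+ 2 + b0 ^+ 2 + A) by rewrite invrK.
  have e3 : a0 ^+ 2 + b0 ^+ 2 = w^-1 - w'^-1 by rewrite e1 e2; ring.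
  rewrite e3 -subr_ge0.
  have -> : w' - w * (1 + w * (w^-1 - w'^-1)) = (w' - w) ^+ 2 / w'.
    by field; rewrite (gt_eqF w0) (gt_eqF w'0).
  by rewrite divr_ge0 ?sqr_ge0 // ltW.
(* [u] pairs [(a0, b0)] with [(s, t)] through the symmetric 2 by 2 matrix with diagonal [k] and
   off-diagonal entry [l], whose spectral norm is [k + |l| = w]. *)
have uw : u ^+ 2 <= w ^+ 2 * (a0 ^+ 2 + b0 ^+ 2) * (s ^+ 2 + t ^+ 2).
  set k := w - `|l|.
  have k0 : 0 <= k by rewrite subr_ge0.
  have CS : u ^+ 2 <= ((l * b0 + k * a0) ^+ 2 + (l * a0 + k * b0) ^+ 2) * (s ^+ 2 + t ^+ 2).
    have -> : u = (l * b0 + k * a0) * s + (l * a0 + k * b0) * t by rewrite /u -/k; ring.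
    rewrite -subr_ge0.
    set x1 := l * b0 + _; set x2 := l * a0 + _.
    have -> : (x1 ^+ 2 + x2 ^+ 2) * (s ^+ 2 + t ^+ 2) - (x1 * s + x2 * t) ^+ 2
       = (x1 * t - x2 * s) ^+ 2 by ring.
    exact: sqr_ge0.
  apply: (le_trans CS); rewrite ler_wpM2r ?addr_ge0 ?sqr_ge0//.
  have lk : l * k * (4 * (a0 * b0)) <= `|l| * k * (2 * (a0 ^+ 2 + b0 ^+ 2)).
    apply: le_trans (ler_norm _) _; rewrite !normrM (ger0_norm k0).
    rewrite ler_wpM2l ?mulr_ge0// (@ger0_norm _ 4)//.
    rewrite -(real_normK (num_real a0)) -(real_normK (num_real b0)).
    by have := sqr_ge0 (`|a0| - `|b0|); lra.
  have -> : w = `|l| + k by rewrite /k; ring.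
  have -> : (`|l| + k) ^+ 2 = l ^+ 2 + 2 * (`|l| * k) + k ^+ 2.
    by rewrite -(real_normK (num_real l)); ring.
  have -> : (l * b0 + k * a0) ^+ 2 + (l * a0 + k * b0) ^+ 2
      = (l ^+ 2 + k ^+ 2) * (a0 ^+ 2 + b0 ^+ 2) + l * k * (4 * (a0 * b0)) by ring.
  lra.
apply: (@le_trans _ _ (Q + w ^+ 2 * (a0 ^+ 2 + b0 ^+ 2) * (s ^+ 2 + t ^+ 2) / 2)).
  lra.
have := sqr_ge0 s; have := sqr_ge0 t.
rewrite /Q !addrA; nra.
Qed.

(** In [sign_avg_expR_bilin] with [L = 8 * K / eta], the inverse of [|l|], the auxiliary square term
    is absent at the start. At the end it is [((L - S)^-1 - L^-1) / 2 * S], which is of second order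
    in [eta] because [S <= 2 * K]. *)
Lemma sign_avg_expR_centered (R : realType) (n : nat) (a b : 'I_n -> R)
    (K eta l : R) :
  0 < K -> 0 < eta <= 1 -> `|l| = eta / (8 * K) ->
  \sum_i a i ^+ 2 <= K -> \sum_i b i ^+ 2 <= K ->
  sign_avg (fun q => expR (l * ((\sum_i q i * a i) * (\sum_i q i * b i)
                                - \sum_i a i * b i)))
  <= expR (eta ^+ 2 / 24).
Proof.
move=> K0 /andP[eta0 eta1] lE aK bK.
set rho := \sum_i a i * b i.
set S := \sum_i (a i ^+ 2 + b i ^+ 2).
pose L : R := 8 * K / eta.
have SK : S <= 2 * K by rewrite /S big_split/=; lra.
have S0 : 0 <= S by apply: sumr_ge0 => i _; rewrite addr_ge0 ?sqr_ge0.
have K_neq0 := lt0r_neq0 K0; have eta_neq0 := lt0r_neq0 eta0.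
have L8 : 8 * K <= L by rewrite /L ler_pdivlMr//; nra.
have LE : `|l| = L^-1 by rewrite lE /L invf_div.
have SL : S < L by lra.
have := @sign_avg_expR_bilin R n a b 0 0 l L SL.
rewrite LE lexx => /(_ isT) /=.
rewrite mulr0 expr0n/= !add0r -/S -/rho => H.
have -> : (fun q : 'I_n -> R => expR (l * ((\sum_i q i * a i) * (\sum_i q i * b i) - rho)))
  = (fun q => expR (- (l * rho)) * expR (l * ((0 + \sum_i q i * a i) * (0 + \sum_i q i * b i))
    + (L^-1 - L^-1) / 2 * ((0 + \sum_i q i * a i) ^+ 2 + (0 + \sum_i q i * b i) ^+ 2))).
  by apply/funext => q; rewrite -expRD; congr expR; ring.
rewrite sign_avgZ.
apply: (le_trans (ler_wpM2l (expR_ge0 _) H)).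
rewrite -expRD ler_expR addrA addNr add0r.
(* [B] is an upper bound for [(L - 2 * K)^-1] with [B - L^-1 = eta^2 / (24 * K)]; the excess
   [eta * (1 - eta) / 12] of [B * (L - 2 * K)] over 1 is nonnegative since [eta <= 1]. *)
pose B : R := eta / (8 * K) + eta ^+ 2 / (24 * K).
have B0 : 0 <= B by rewrite addr_ge0 ?divr_ge0 ?mulr_ge0 ?sqr_ge0// ltW.
have wB : (L - S)^-1 <= B.
  rewrite -[leLHS]mul1r ler_pdivrMr ?subr_gt0//.
  apply: (@le_trans _ _ (B * (L - 2 * K))); last first.
    by apply: ler_wpM2l => //; lra.
  have -> : B * (L - 2 * K) = 1 + eta * (1 - eta) / 12.
    by rewrite /B /L; field; rewrite eta_neq0 K_neq0.
  by rewrite lerDl divr_ge0// mulr_ge0 ?(ltW eta0)// subr_ge0.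
have -> : eta ^+ 2 / 24 = (B - L^-1) / 2 * (2 * K).
  by rewrite /B /L; field; rewrite eta_neq0 K_neq0.
apply: ler_pM => //; last by rewrite ler_pM2r ?invr_gt0// lerD2r.
rewrite divr_ge0// subr_ge0 lef_pV2 ?posrE ?subr_gt0 ?gerBl//; lra.
Qed.

(* Conditional expectations: each new sign vector is chosen so that the sum of
   exponentials grows by a factor at most [B]. *)
Lemma greedy_signs (R : realType) (n : nat) (I : finType)
    (f : I -> ('I_n -> R) -> R) (B : R) (r : nat) :
  (forall i, sign_avg (fun q => expR (f i q)) <= B) ->
  exists q : nat -> 'I_n -> R,
    \sum_i expR (\sum_(k < r) f i (q k)) <= #|I|%:R * B ^+ r.
Proof.
move=> fB; elim: r => [|r [q qB]].
  exists (fun _ _ => 0); under eq_bigr do rewrite big_ord0 expR0.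
  by rewrite sumr_const expr0 mulr1 cardT -cardE.
pose F p := \sum_i expR (\sum_(k < r) f i (q k)) * expR (f i p).
have [p pF] := sign_avg_le F.
exists (fun k => if k == r then p else q k).
have -> : \sum_i expR (\sum_(k < r.+1) f i (if k == r :> nat then p else q k)) = F p.
  apply: eq_bigr => i _; rewrite big_ord_recr/= eqxx expRD; congr (expR _ * _).
  by apply: eq_bigr => k _; rewrite ltn_eqF.
apply: (le_trans pF); rewrite sign_avg_sum exprSr mulrA.
(* For empty [I] both sides vanish; otherwise [B] bounds an average of exponentials and is
   nonnegative. *)
have [i0 _|I0] := pickP I; last first.
  rewrite big_pred0//; have -> : #|I| = 0%N by apply: eq_card0 => x; have := I0 x.
  by rewrite !mul0r.
have B0 : 0 <= B.
  by have [p' p'B] := sign_avg_le (fun q => expR (f i0 q));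
    exact: le_trans (expR_ge0 _) (le_trans p'B (fB i0)).
apply: (@le_trans _ _ (\sum_i expR (\sum_(k < r) f i (q k)) * B)).
  by apply: ler_sum => i _; rewrite sign_avgZ ler_wpM2l ?expR_ge0.
by rewrite -mulr_suml ler_wpM2r.
Qed.

(** * Low-rank sketch of a Gram matrix *)

Lemma mxrank_sum_le (F : fieldType) (m n : nat) (I : Type) (s : seq I)
    (A : I -> 'M[F]_(m, n)) (k : nat) :
  (forall i, (\rank (A i) <= k)%N) -> (\rank (\sum_(i <- s) A i)%R <= size s * k)%N.
Proof.
move=> Ak; elim: s => [|i s IH]; first by rewrite big_nil mxrank0.
by rewrite big_cons (leq_trans (mxrank_add _ _))// mulSn leq_add.
Qed.

(** [G] is the mean of the [r] rank-one matrices with entries [X (q k) i * Y (q k) j]. A Chernoff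
    bound with a union over all entries and both tails controls the deviation; the boolean in the
    index of [f] selects the tail. *)
Lemma gram_sketch (R : realType) (n n1 n2 : nat)
    (a : 'I_n1 -> 'I_n -> R) (b : 'I_n2 -> 'I_n -> R) (K eta : R) (r : nat) :
  0 < K -> 0 < eta <= 1 ->
  (forall i, \sum_l a i l ^+ 2 <= K) -> (forall j, \sum_l b j l ^+ 2 <= K) ->
  16 * ln (3 * n1%:R * n2%:R) <= r%:R * eta ^+ 2 ->
  exists G : 'M[R]_(n1, n2), (\rank G <= r)%N /\
    forall i j, `|\sum_l a i l * b j l - G i j| <= eta * K.
Proof.
move=> K0 eta01 aK bK hr; have /andP[eta0 eta1] := eta01.
pose l (e : bool) : R := (-1) ^+ e * (eta / (8 * K)).
pose X q i := \sum_l q l * a i l.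
pose Y q j := \sum_l q l * b j l.
pose rho i j := \sum_l a i l * b j l.
pose f (p : 'I_n1 * 'I_n2 * bool) (q : 'I_n -> R) :=
  l p.2 * (X q p.1.1 * Y q p.1.2 - rho p.1.1 p.1.2).
have leta e : `|l e| = eta / (8 * K).
  by rewrite /l normrM normrX normrN1 expr1n mul1r ger0_norm// divr_ge0 ?mulr_ge0// ltW.
have fB p : sign_avg (fun q => expR (f p q)) <= expR (eta ^+ 2 / 24).
  exact: (@sign_avg_expR_centered R n (a p.1.1) (b p.1.2) K eta (l p.2)).
have [q qB] := greedy_signs r fB.
pose G := r%:R^-1 *: \sum_(k < r) ((\col_i X (q k) i) *m (\row_j Y (q k) j)).
have cardE : #|{: 'I_n1 * 'I_n2 * bool}| = (n1 * n2 * 2)%N.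
  by rewrite !card_prod !card_ord card_bool.
exists G; split.
  rewrite (leq_trans (mxrank_scale _ _))// -[in leqRHS](size_enum_ord r) -[leqRHS]muln1.
  rewrite -big_enum; apply: mxrank_sum_le => k.
  by rewrite (leq_trans (mxrankM_maxl _ _))// rank_leq_col.
move=> i j.
have N0 : 0 < (n1 * n2)%:R :> R.
  by rewrite ltr0n muln_gt0 (leq_ltn_trans _ (ltn_ord i))// (leq_ltn_trans _ (ltn_ord j)).
have N1 : 1 <= (n1 * n2)%:R :> R by rewrite ler1n -(ltr0n R).
(* The hypothesis relating [r] to [eta] forces [r > 0], because the logarithm is positive. *)
have r0 : 0 < r%:R :> R.
  have := @ln_gt0 R (3 * n1%:R * n2%:R); rewrite -mulrA -natrM => ln0.
  have : 0 < ln (3 * (n1 * n2)%:R : R) by apply: ln0; lra.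
  rewrite natrM mulrA => ln0'.
  by have := sqr_ge0 eta; have := ler0n R r; nra.
set Z := \sum_(k < r) X (q k) i * Y (q k) j - r%:R * rho i j.
have GE : rho i j - G i j = - (r%:R^-1 * Z).
  rewrite /Z mulrBr mulrA mulVf ?gt_eqF// mul1r opprB /G !mxE summxE; congr (_ - _ * _).
  by apply: eq_bigr => k _; rewrite !mxE big_ord1 !mxE.
have lZ e : l e * Z <= ln (3 * n1%:R * n2%:R) + r%:R * (eta ^+ 2 / 24).
  have -> : l e * Z = \sum_(k < r) f (i, j, e) (q k).
    rewrite -mulr_sumr sumrB; congr (_ * (_ - _)).
    by rewrite sumr_const card_ord mulr_natl.
  rewrite -mulrA -natrM -ler_expR expRD lnK ?posrE ?mulr_gt0//.
  (* One exponential is at most the whole sum, whose index set has [2 * n1 * n2 <= 3 * n1 * n2]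
     elements. *)
  rewrite expRM_natl; apply: le_trans (le_trans qB _); last first.
    rewrite cardE natrM ler_wpM2r ?exprn_ge0 ?expR_ge0//.
    by rewrite mulrC ler_pM2r// ler_nat.
  rewrite (bigD1 (i, j, e))//= lerDl sumr_ge0// => p _; exact: expR_ge0.
have lnN : ln (3 * n1%:R * n2%:R) <= r%:R * eta ^+ 2 / 16 by rewrite ler_pdivlMr//; lra.
(* The two tails together bound [|Z|], and [1/16 + 1/24 <= 1/8]. *)
have absZ : eta / (8 * K) * `|Z| <= r%:R * eta ^+ 2 / 8.
  have h0 := lZ false; have h1 := lZ true.
  have : 0 <= r%:R * eta ^+ 2 by rewrite mulr_ge0 ?sqr_ge0.
  rewrite /l expr0 expr1 in h0 h1.
  by case: (ger0P Z) => _; lra.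
rewrite GE normrN normrM normfV normr_nat mulrC ler_pdivrMr//.
have -> : `|Z| = (eta / (8 * K) * `|Z|) * (8 * K / eta).
  by field; rewrite !gt_eqF.
have -> : eta * K * r%:R = (r%:R * eta ^+ 2 / 8) * (8 * K / eta).
  by field; rewrite !gt_eqF.
by rewrite ler_wpM2r// divr_ge0// ?mulr_ge0// ltW.
Qed.

(** * Calculus of the factorization norm gamma_2 *)

(** Lagrange's identity: twice the defect is the double sum of the squares
    [(a s * b t - a t * b s)^2]. *)
Lemma CauchySchwarz_sum (R : realDomainType) (T : finType) (a b : T -> R) :
  (\sum_t a t * b t) ^+ 2 <= (\sum_t a t ^+ 2) * (\sum_t b t ^+ 2).
Proof.
have H : 0 <= \sum_s \sum_t (a s * b t - a t * b s) ^+ 2.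
  by apply: sumr_ge0 => s _; apply: sumr_ge0 => t _; exact: sqr_ge0.
have E : \sum_s \sum_t (a s * b t - a t * b s) ^+ 2
    = (\sum_t a t ^+ 2) * (\sum_t b t ^+ 2) * 2 - (\sum_t a t * b t) ^+ 2 * 2.
  under eq_bigr => s _.
    rewrite (eq_bigr (fun t => a s ^+ 2 * b t ^+ 2 + a t ^+ 2 * b s ^+ 2
      + (-2) * ((a s * b s) * (a t * b t)))); last by move=> t _; ring.
    rewrite !big_split/= -!mulr_sumr -mulr_suml.
    over.
  by rewrite !big_split/= -mulr_suml -!mulr_sumr -mulr_suml; ring.
by move: H; rewrite E; lra.
Qed.

(* The bound [K] on the factorization norm gamma_2 of the matrix [F]. *)
Definition gamma2_le (R : realType) (n1 n2 : nat) (F : 'I_n1 -> 'I_n2 -> R)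
    (K : R) : Prop :=
  exists (T : finType) (a : 'I_n1 -> T -> R) (b : 'I_n2 -> T -> R),
    [/\ forall i, \sum_t a i t ^+ 2 <= K, forall j, \sum_t b j t ^+ 2 <= K
      & forall i j, F i j = \sum_t a i t * b j t].

Section Gamma2.
Variables (R : realType) (n1 n2 : nat).
Implicit Types F G : 'I_n1 -> 'I_n2 -> R.

Lemma gamma2_abs_le F K i j : gamma2_le F K -> `|F i j| <= K.
Proof.
move=> [T [a [b [aK bK ->]]]].
have K0 : 0 <= K by apply: le_trans (aK i); apply: sumr_ge0 => t _; exact: sqr_ge0.
rewrite -ler_sqr ?nnegrE// real_normK ?num_real//.
apply: (le_trans (CauchySchwarz_sum _ _)); rewrite expr2.
by apply: ler_pM => //; apply: sumr_ge0 => t _; exact: sqr_ge0.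
Qed.

(** Scaling one factor by [c = sqrt (B / A)] and the other by [c^-1] balances the two bounds at
    [A * B]. If [A * B = 0], all entries vanish by Cauchy-Schwarz and the empty index type
    serves. *)
Lemma gamma2_dot (T : finType) (a : 'I_n1 -> T -> R) (b : 'I_n2 -> T -> R)
    (A B : R) :
  0 <= A -> 0 <= B ->
  (forall i, \sum_t a i t ^+ 2 <= A ^+ 2) -> (forall j, \sum_t b j t ^+ 2 <= B ^+ 2) ->
  gamma2_le (fun i j => \sum_t a i t * b j t) (A * B).
Proof.
move=> A0 B0 aA bB.
have [AB0|] := eqVneq (A * B) 0.
  exists void, (fun _ _ => 0), (fun _ _ => 0); split => [i|j|i j].
  - by rewrite AB0 big1// => -[].
  - by rewrite AB0 big1// => -[].
  rewrite [RHS]big1; last by case.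
  apply/eqP; rewrite -sqrf_eq0 eq_le sqr_ge0 andbT.
  apply: (le_trans (CauchySchwarz_sum _ _)).
  apply: (@le_trans _ _ (A ^+ 2 * B ^+ 2)); last by rewrite -exprMn AB0 expr0n.
  by apply: ler_pM => //; apply: sumr_ge0 => t _; exact: sqr_ge0.
rewrite mulf_eq0 negb_or => /andP[An0 Bn0].
have {}A0 : 0 < A by rewrite lt0r An0.
have {}B0 : 0 < B by rewrite lt0r Bn0.
pose c := Num.sqrt (B / A).
have c2 : c ^+ 2 = B / A by rewrite sqr_sqrtr// divr_ge0// ltW.
have c0 : c != 0 by rewrite sqrtr_eq0 -ltNge divr_gt0.
exists T, (fun i t => c * a i t), (fun j t => c^-1 * b j t); split => [i|j|i j].
- under eq_bigr do rewrite exprMn; rewrite -mulr_sumr c2.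
  have -> : A * B = B / A * A ^+ 2 by field.
  by rewrite ler_wpM2l// divr_ge0// ltW.
- under eq_bigr do rewrite exprMn exprVn; rewrite -mulr_sumr c2 invf_div.
  have -> : A * B = A / B * B ^+ 2 by field.
  by rewrite ler_wpM2l// divr_ge0// ltW.
- by apply: eq_bigr => t _; rewrite mulrACA divff// mul1r.
Qed.

Lemma eq_gamma2 F G K : (forall i j, F i j = G i j) -> gamma2_le F K -> gamma2_le G K.
Proof.
by move=> FG [T [a [b [aK bK E]]]]; exists T, a, b; split => // i j; rewrite -FG.
Qed.

Lemma gamma2_row (f : 'I_n1 -> R) (A : R) :
  0 <= A -> (forall i, `|f i| <= A) -> gamma2_le (fun i (_ : 'I_n2) => f i) A.
Proof.
move=> A0 fA; rewrite -(mulr1 A).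
apply: eq_gamma2 (@gamma2_dot unit (fun i _ => f i) (fun _ _ => 1) A 1 _ _ _ _) => //.
- by move=> i j; rewrite big_const card_unit/= addr0 mulr1.
- move=> i; rewrite big_const card_unit/= addr0.
  by rewrite -(real_normK (num_real (f i))) ler_sqr ?nnegrE.
- by move=> j; rewrite big_const card_unit/= addr0.
Qed.

Lemma gamma2_col (f : 'I_n2 -> R) (A : R) :
  0 <= A -> (forall j, `|f j| <= A) -> gamma2_le (fun (_ : 'I_n1) j => f j) A.
Proof.
move=> A0 fA; rewrite -(mul1r A).
apply: eq_gamma2 (@gamma2_dot unit (fun _ _ => 1) (fun j _ => f j) 1 A _ _ _ _) => //.
- by move=> i j; rewrite big_const card_unit/= addr0 mul1r.
- by move=> i; rewrite big_const card_unit/= addr0.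
- move=> j; rewrite big_const card_unit/= addr0.
  by rewrite -(real_normK (num_real (f j))) ler_sqr ?nnegrE.
Qed.

Lemma gamma2_cst (c A : R) : `|c| <= A -> gamma2_le (fun (_ : 'I_n1) (_ : 'I_n2) => c) A.
Proof. by move=> cA; apply: gamma2_row => //; exact: le_trans cA. Qed.

(** Concatenate the factor vectors. *)
Lemma gamma2D F G K L : gamma2_le F K -> gamma2_le G L ->
  gamma2_le (fun i j => F i j + G i j) (K + L).
Proof.
move=> [T [a [b [aK bK FE]]]] [U [c [d [cL dL GE]]]].
exists (T + U)%type, (fun i x => match x with inl t => a i t | inr u => c i u end),
  (fun j x => match x with inl t => b j t | inr u => d j u end).
split => [i|j|i j]; rewrite big_sumType/=; first exact: lerD.
  exact: lerD.
by rewrite FE GE.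
Qed.

(** Tensor the factor vectors: inner products and squared norms multiply. *)
Lemma gamma2M F G K L : gamma2_le F K -> gamma2_le G L ->
  gamma2_le (fun i j => F i j * G i j) (K * L).
Proof.
move=> [T [a [b [aK bK FE]]]] [U [c [d [cL dL GE]]]].
have sq0 (V : finType) (f : V -> R) : 0 <= \sum_t f t ^+ 2.
  by apply: sumr_ge0 => t _; exact: sqr_ge0.
exists (T * U)%type, (fun i x => a i x.1 * c i x.2), (fun j x => b j x.1 * d j x.2).
have E (f g : T -> R) (f' g' : U -> R) :
    \sum_x (f x.1 * f' x.2) * (g x.1 * g' x.2)
    = (\sum_t f t * g t) * (\sum_u f' u * g' u).
  by rewrite big_distrlr/= pair_bigA/=; apply: eq_bigr => x _; ring.
split => [i|j|i j].
- under eq_bigr do rewrite expr2; rewrite E.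
  by under eq_bigr do rewrite -expr2; under [X in _ * X]eq_bigr do rewrite -expr2;
    exact: ler_pM.
- under eq_bigr do rewrite expr2; rewrite E.
  by under eq_bigr do rewrite -expr2; under [X in _ * X]eq_bigr do rewrite -expr2;
    exact: ler_pM.
- by rewrite E FE GE.
Qed.

Lemma gamma2X F K (s : nat) : gamma2_le F K ->
  gamma2_le (fun i j => F i j ^+ s) (K ^+ s).
Proof.
move=> FK; elim: s => [|s IH]; first by apply: gamma2_cst; rewrite expr0 normr1.
rewrite exprS; apply: eq_gamma2 (gamma2M FK IH) => i j; by rewrite exprS.
Qed.

(** When [eta > 1] or [K <= 0] the zero matrix suffices, since [|F i j| <= K]. Otherwise the index
    type is enumerated and [gram_sketch] applies. *)
Lemma gamma2_sketch F K eta (r : nat) :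
  0 < eta -> gamma2_le F K -> 16 * ln (3 * n1%:R * n2%:R) <= r%:R * eta ^+ 2 ->
  exists G : 'M[R]_(n1, n2), (\rank G <= r)%N /\
    forall i j, `|F i j - G i j| <= eta * K.
Proof.
move=> eta0 FK hr.
have FleK i j := gamma2_abs_le i j FK.
have [eta1|eta1] := leP eta 1; last first.
  exists 0; rewrite mxrank0; split => // i j; rewrite mxE subr0.
  have := FleK i j; have := normr_ge0 (F i j); nra.
have [K0|K0] := leP K 0.
  exists 0; rewrite mxrank0; split => // i j; rewrite mxE subr0.
  have := FleK i j; have := normr_ge0 (F i j); nra.
have [T [a [b [aK bK FE]]]] := FK.
have E (f : T -> R) : \sum_t f t = \sum_(l < #|T|) f (enum_val l).
  by rewrite (reindex (@enum_val T xpredT))//; exact/onW_bij/enum_val_bij.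
have [|i|j|//|G [rG GE]] := @gram_sketch R #|T| n1 n2 (fun i l => a i (enum_val l))
  (fun j l => b j (enum_val l)) K eta r K0.
- by rewrite eta0.
- by rewrite -(E (fun t => a i t ^+ 2)).
- by rewrite -(E (fun t => b j t ^+ 2)).
by exists G; split => // i j; rewrite FE E.
Qed.

End Gamma2.

(** * Spectral norm and quadratic forms *)

Section QuadraticForm.
Variable R : realType.

Lemma norm2_ge0 m (x : 'cV[R]_m) : 0 <= norm2 x.
Proof. exact: sqrtr_ge0. Qed.

Lemma sqr_norm2 m (x : 'cV[R]_m) : norm2 x ^+ 2 = \sum_i x i 0 ^+ 2.
Proof. by rewrite sqr_sqrtr// sumr_ge0// => i _; exact: sqr_ge0. Qed.

Lemma norm2Z m (c : R) (x : 'cV[R]_m) : norm2 (c *: x) = `|c| * norm2 x.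
Proof.
rewrite /norm2; under eq_bigr do rewrite mxE exprMn.
by rewrite -mulr_sumr sqrtrM ?sqr_ge0// sqrtr_sqr.
Qed.

Lemma norm2_eq0 m (x : 'cV[R]_m) : norm2 x = 0 -> x = 0.
Proof.
move=> x0; have /eqP := sqr_norm2 x; rewrite x0 expr0n/= eq_sym psumr_eq0; last first.
  by move=> i _; exact: sqr_ge0.
move=> /allP x0'; apply/colP => i; rewrite mxE; apply/eqP.
by rewrite -sqrf_eq0; apply: (implyP (x0' i (mem_index_enum i))).
Qed.

(** The Frobenius norm is an upper bound, so the [sup] defining [spectral_norm] is a true least
    upper bound. *)
Lemma has_ubound_spectral m n (W : 'M[R]_(m, n)) :
  has_ubound [set norm2 (W *m x) | x in [set x : 'cV[R]_n | norm2 x <= 1]].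
Proof.
exists (Num.sqrt (\sum_i \sum_j W i j ^+ 2)) => _ [z /= z1 <-].
rewrite ler_sqrt; last first.
  by apply: sumr_ge0 => i _; apply: sumr_ge0 => j _; exact: sqr_ge0.
apply: ler_sum => i _; rewrite mxE.
apply: (le_trans (CauchySchwarz_sum _ _)); rewrite -[leRHS]mulr1.
rewrite ler_wpM2l//; first by apply: sumr_ge0 => j _; exact: sqr_ge0.
by rewrite -sqr_norm2 expr_le1// norm2_ge0.
Qed.

Lemma norm20 m : norm2 (0 : 'cV[R]_m) = 0.
Proof. by rewrite -(scale0r (0 : 'cV_m)) norm2Z normr0 mul0r. Qed.

Lemma spectral_norm_ge0 m n (W : 'M[R]_(m, n)) : 0 <= spectral_norm W.
Proof.
apply: (ub_le_sup (has_ubound_spectral W)).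
by exists 0; rewrite /= ?mulmx0 norm20.
Qed.

Lemma norm2_mulmx_le m n (W : 'M[R]_(m, n)) (x : 'cV[R]_n) :
  norm2 (W *m x) <= spectral_norm W * norm2 x.
Proof.
have [/norm2_eq0 ->|x0] := eqVneq (norm2 x) 0.
  by rewrite mulmx0 !norm20 mulr0.
have {}x0 : 0 < norm2 x by rewrite lt0r x0 norm2_ge0.
rewrite -ler_pdivrMr//; apply: (ub_le_sup (has_ubound_spectral W)).
exists ((norm2 x)^-1 *: x) => /=.
  by rewrite norm2Z ger0_norm ?invr_ge0 ?norm2_ge0// mulVf// gt_eqF.
by rewrite -scalemxAr norm2Z ger0_norm ?invr_ge0 ?norm2_ge0// mulrC.
Qed.

Lemma bilin_formE m (W : 'M[R]_m) (x y : 'cV[R]_m) :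
  (x^T *m W *m y) 0 0 = \sum_k x k 0 * (W *m y) k 0.
Proof. by rewrite -mulmxA mxE; apply: eq_bigr => k _; rewrite mxE. Qed.

Lemma bilin_form_sym m (W : 'M[R]_m) (x y : 'cV[R]_m) :
  W^T = W -> (x^T *m W *m y) 0 0 = (y^T *m W *m x) 0 0.
Proof.
move=> WT; have -> : y^T *m W *m x = (x^T *m W *m y)^T.
  by rewrite !trmx_mul trmxK WT mulmxA.
by rewrite [RHS]mxE.
Qed.

Lemma quad_form_ge0 m (W : 'M[R]_m) (x : 'cV[R]_m) :
  sym_posdef W -> 0 <= (x^T *m W *m x) 0 0.
Proof.
move=> [_ Wp]; have [->|/Wp/ltW//] := eqVneq x 0.
by rewrite mulmx0 mxE.
Qed.

Lemma quad_formB m (W : 'M[R]_m) (x y : 'cV[R]_m) : W^T = W ->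
  ((x - y)^T *m W *m (x - y)) 0 0
  = (x^T *m W *m x) 0 0 + (y^T *m W *m y) 0 0 - 2 * (x^T *m W *m y) 0 0.
Proof.
move=> WT; rewrite [(x - y)^T]raddfB/= mulmxBl mulmxBr !mulmxBl.
rewrite !mxE; have := bilin_form_sym x y WT.
rewrite !mxE => ->; ring.
Qed.

Lemma bilin_form_le m (W : 'M[R]_m) (x y : 'cV[R]_m) (rad : R) :
  norm2 x <= rad -> norm2 y <= rad ->
  `|(x^T *m W *m y) 0 0| <= spectral_norm W * rad ^+ 2.
Proof.
move=> xr yr; have r0 : 0 <= rad by exact: le_trans (norm2_ge0 x) xr.
apply: (@le_trans _ _ (norm2 x * norm2 (W *m y))).
  rewrite bilin_formE -ler_sqr ?nnegrE ?mulr_ge0 ?norm2_ge0//.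
  rewrite real_normK ?num_real// exprMn !sqr_norm2; exact: CauchySchwarz_sum.
have -> : spectral_norm W * rad ^+ 2 = rad * (spectral_norm W * rad) by ring.
apply: ler_pM; rewrite ?norm2_ge0//.
by apply: (le_trans (norm2_mulmx_le _ _)); rewrite ler_wpM2l ?spectral_norm_ge0.
Qed.

End QuadraticForm.

(** * Factorization of the shifted squared distances *)

Lemma sqr_wnorm (R : realType) (m : nat) (W : 'M[R]_m) (z : 'cV[R]_m) :
  sym_posdef W -> wnorm W z ^+ 2 = (z^T *m W *m z) 0 0.
Proof. by move=> hW; rewrite sqr_sqrtr// quad_form_ge0. Qed.

Section SquaredDistances.
Variables (R : realType) (m n1 n2 : nat) (W : 'M[R]_m) (rad : R).
Variables (x : 'I_n1 -> 'cV[R]_m) (y : 'I_n2 -> 'cV[R]_m).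
Hypotheses (hW : sym_posdef W) (rad_ge0 : 0 <= rad).
Hypotheses (hx : forall i, norm2 (x i) <= rad) (hy : forall j, norm2 (y j) <= rad).
Let w := spectral_norm W * rad ^+ 2.

Lemma sqr_wnormB_le i j : wnorm W (x i - y j) ^+ 2 <= 4 * w.
Proof.
rewrite sqr_wnorm// quad_formB; last by case: hW.
have := bilin_form_le W (hx i) (hx i); have := bilin_form_le W (hy j) (hy j).
have := bilin_form_le W (hx i) (hy j); rewrite !ler_norml -/w.
by move=> /andP[? ?] /andP[? ?] /andP[? ?]; lra.
Qed.

(* Centering each of [x^T W x] and [y^T W y], whose values lie in [0, w], at
   [w / 2] brings the bound down to [6 w]; the room left by the factor [8] of
   the theorem allows the relative accuracy [4 / 3 eps] in [gamma2_sketch]. *)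
Lemma gamma2_sqr_wnormB (c : R) : 0 <= c <= 4 * w ->
  gamma2_le (fun i j => wnorm W (x i - y j) ^+ 2 - c) (6 * w).
Proof.
move=> /andP[c0 c4].
have w0 : 0 <= w by rewrite mulr_ge0 ?spectral_norm_ge0 ?sqr_ge0.
have half (z : 'cV[R]_m) : norm2 z <= rad ->
    `|(z^T *m W *m z) 0 0 - w / 2| <= w / 2.
  move=> zr; have := bilin_form_le W zr zr; have := quad_form_ge0 z hW.
  by rewrite !ler_norml -/w => ? /andP[? ?]; apply/andP; split; lra.
have gx := @gamma2_row R n1 n2 (fun i => ((x i)^T *m W *m x i) 0 0 - w / 2) (w / 2).
have gy := @gamma2_col R n1 n2 (fun j => ((y j)^T *m W *m y j) 0 0 - w / 2) (w / 2).
have {}gx := gx (divr_ge0 w0 (ler0n _ 2)) (fun i => half _ (hx i)).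
have {}gy := gy (divr_ge0 w0 (ler0n _ 2)) (fun i => half _ (hy i)).
(* The constant [w] restores the two halves removed by the centering; as [0 <= c <= 4 * w], the
   value [w - c] lies in [[-3 w, w]]. *)
have gc : gamma2_le (fun (_ : 'I_n1) (_ : 'I_n2) => w - c) (3 * w).
  by apply: gamma2_cst; rewrite ler_norml; apply/andP; split; lra.
have gm2 : gamma2_le (fun (_ : 'I_n1) (_ : 'I_n2) => -2 : R) 2.
  by apply: gamma2_cst; rewrite normrN ger0_norm.
have gb : gamma2_le (fun i j => ((x i)^T *m W *m y j) 0 0) w.
  have -> : w = rad * (spectral_norm W * rad) by rewrite /w; ring.
  apply: eq_gamma2 (@gamma2_dot _ _ _ _ (fun i k => x i k 0)
     (fun j k => (W *m y j) k 0) _ _ rad_ge0 _ _ _).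
  - by move=> i j; rewrite bilin_formE.
  - by rewrite mulr_ge0 ?spectral_norm_ge0.
  - by move=> i; rewrite -sqr_norm2 ler_sqr ?nnegrE ?norm2_ge0.
  move=> j; rewrite -sqr_norm2 ler_sqr ?nnegrE ?norm2_ge0 ?mulr_ge0 ?spectral_norm_ge0//.
  by apply: (le_trans (norm2_mulmx_le _ _)); rewrite ler_wpM2l ?spectral_norm_ge0.
have := gamma2D (gamma2D gx gy) (gamma2D gc (gamma2M gm2 gb)).
have -> : w / 2 + w / 2 + (3 * w + 2 * w) = 6 * w by field.
apply: eq_gamma2 => i j.
by rewrite sqr_wnorm// quad_formB; [field|case: hW].
Qed.

End SquaredDistances.

(** * Taylor's formula with Lagrange remainder on a closed interval *)

Lemma is_derive_subX (R : realType) (n : nat) (u v : R) :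
  is_derive v 1 (fun z : R => (u - z) ^+ n.+1) (- (n.+1%:R * (u - v) ^+ n)).
Proof.
have -> : (fun z : R => (u - z) ^+ n.+1) = (cst u - id) ^+ n.+1.
  by apply/funext => z; rewrite exprfctE.
apply: is_derive_eq; rewrite /GRing.scale/= -mulr_natl sub0r mulrN1; congr (- _).
Qed.

Lemma continuous_subX (R : realType) (n : nat) (u : R) :
  continuous (fun z : R => (u - z) ^+ n).
Proof.
move=> z; apply: (@continuous_comp _ _ _ (fun z => u - z) (fun z => z ^+ n)).
  by apply: continuousB; [exact: cst_continuous|].
exact: exprn_continuous.
Qed.

Section Taylor.
Variables (R : realType) (g : nat -> R -> R) (a b : R).
Hypothesis g_derive : forall s (v : R), v \in `]a, b[ -> is_derive v 1 (g s) (g s.+1 v).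
Hypothesis g_cont : forall s, {within `[a, b], continuous (g s)}.

(** Taylor polynomial with [t] terms, seen as a function of the expansion point [v] for a fixed
    argument [u]. *)
Let T (t : nat) (u v : R) := \sum_(s < t) g s v / s`!%:R * (u - v) ^+ s.

(** Differentiation in the expansion point telescopes; only the last term survives. *)
Lemma is_derive_taylor_poly (t : nat) (u v : R) : v \in `]a, b[ ->
  is_derive v 1 (T t.+1 u) (g t.+1 v / t`!%:R * (u - v) ^+ t).
Proof.
move=> vab; elim: t => [|t IH].
  have -> : T 1 u = g 0.
    by apply/funext => z; rewrite /T big_ord1 expr0 fact0 divr1 mulr1.
  by rewrite fact0 divr1 expr0 mulr1; exact: g_derive.
have -> : T t.+2 u
    = T t.+1 u + (g t.+1 * cst (t.+1`!%:R)^-1) * (fun z => (u - z) ^+ t.+1).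
  by apply/funext => z; rewrite /T big_ord_recr.
have gd := g_derive t.+1 vab.
have pd := is_derive_subX t u v.
have gcd := is_deriveM gd (is_derive_cst (t.+1`!%:R^-1 : R) v 1).
apply: is_derive_eq (is_deriveD IH (is_deriveM gcd pd)) _.
rewrite /GRing.scale/= /cst factS natrM.
have t0 : t.+1%:R != 0 :> R by rewrite pnatr_eq0.
have f0 : t`!%:R != 0 :> R by rewrite pnatr_eq0 -lt0n fact_gt0.
rewrite [X in _ + (X * _ + _)](_ : _ = g t.+1 v * (t.+1%:R * t`!%:R)^-1) //.
rewrite exprS; move: t0 f0; move: (t.+1%:R : R) (t`!%:R : R) => p q p0 q0.
by field; rewrite p0 q0.
Qed.

Lemma continuous_taylor_poly (t : nat) (u : R) : {within `[a, b], continuous (T t u)}.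
Proof.
elim: t => [|t IH].
  have -> : T 0 u = cst 0 by apply/funext => z; rewrite /T big_ord0.
  by apply: continuous_subspaceT => z; exact: cst_continuous.
have -> : T t.+1 u = T t u + (fun z => g t z / t`!%:R * (u - z) ^+ t).
  by apply/funext => z; rewrite /T big_ord_recr.
move=> z; apply: continuousD; first exact: IH.
apply: continuousM.
  apply: continuousM; first exact: g_cont.
  exact: cst_continuous.
have h : {within `[a, b], continuous (fun z : R => (u - z) ^+ t)}.
  exact/continuous_subspaceT/continuous_subX.
exact: h.
Qed.

(** Rolle's theorem for [phi], where [k] is chosen so that [phi c = phi u]. A zero [xi] of the
    derivative strictly between [c] and [u] identifies [k] as the Lagrange coefficient. *)
Lemma taylor_Lagrange (c u : R) (t : nat) : (0 < t)%N ->
  c \in `[a, b] -> u \in `[a, b] ->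
  exists2 xi, xi \in `[a, b] &
    g 0 u - \sum_(s < t) g s c / s`!%:R * (u - c) ^+ s
    = g t xi / t`!%:R * (u - c) ^+ t.
Proof.
case: t => // t _ cab uab.
have Tu : T t.+1 u u = g 0 u.
  rewrite /T big_ord_recl big1 ?addr0; last by move=> i _; rewrite subrr expr0n mulr0.
  by rewrite expr0 fact0 divr1 mulr1.
rewrite -Tu -/(T t.+1 u c).
have [uc|cu] := eqVneq u c.
  by exists c => //; rewrite uc !subrr expr0n mulr0.
have cu0 : u - c != 0 by rewrite subr_eq0.
pose k := (T t.+1 u u - T t.+1 u c) / (u - c) ^+ t.+1.
pose phi v := T t.+1 u v + k * (u - v) ^+ t.+1.
have phic : phi c = phi u.
  rewrite /phi subrr expr0n mulr0 addr0 /k divfK ?expf_neq0//; ring.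
have dphi xi : xi \in `]a, b[ ->
    is_derive xi 1 phi ((g t.+1 xi / t`!%:R - k * t.+1%:R) * (u - xi) ^+ t).
  move=> xiab; have dT := is_derive_taylor_poly t u xiab.
  have pd := is_derive_subX t u xi.
  have -> : phi = T t.+1 u + k *: (fun v => (u - v) ^+ t.+1) by [].
  apply: is_derive_eq (is_deriveD dT (is_deriveZ k pd)) _.
  by rewrite /GRing.scale/=; ring.
suff [xi xiab [xiu d0]] : exists2 xi, xi \in `]a, b[ & xi != u /\ is_derive xi 1 phi 0.
  exists xi; first by apply: subset_itvW xiab.
  have d1 := dphi _ xiab.
  have := @derive_val _ _ _ _ _ _ _ d0; rewrite (@derive_val _ _ _ _ _ _ _ d1).
  move/eqP; rewrite mulf_eq0 expf_eq0 !subr_eq0 [u == xi]eq_sym (negbTE xiu).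
  rewrite andbF orbF => /eqP gk.
  have t0 : t.+1%:R != 0 :> R by rewrite pnatr_eq0.
  have -> : g t.+1 xi / t.+1`!%:R = k.
    by rewrite factS natrM invfM mulrCA gk; field.
  by rewrite /k divfK// expf_neq0.
have phi_cont p q : a <= p -> q <= b -> {within `[p, q], continuous phi}.
  move=> ap qb; apply: (@continuous_subspaceW _ _ _ `[a, b]).
    by apply: subset_itv; rewrite bnd_simp.
  move=> z; apply: continuousD; first exact: continuous_taylor_poly.
  have h : {within `[a, b], continuous (fun z : R => k * (u - z) ^+ t.+1)}.
    apply: continuous_subspaceT => z'.
    by apply: cvgM; [exact: cvg_cst|exact: continuous_subX].
  exact: h.
have phi_der v : v \in `]a, b[ -> derivable phi v 1.
  by move=> /dphi [].
move: cab uab; rewrite !in_itv/= => /andP[ac cb] /andP[au ub].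
have sub p q v : a <= p -> q <= b -> v \in `]p, q[ -> v \in `]a, b[.
  rewrite !in_itv/= => ap qb /andP[pv vq].
  by rewrite (le_lt_trans ap pv) (lt_le_trans vq qb).
move: cu; rewrite neq_lt => /orP[uc|cu].
  have [xi xi1 xi2] := Rolle uc (fun v h => phi_der v (sub _ _ v au cb h))
    (phi_cont _ _ au cb) (esym phic).
  exists xi; first exact: sub xi1.
  by split => //; rewrite gt_eqF// (itvP xi1).
have [xi xi1 xi2] := Rolle cu (fun v h => phi_der v (sub _ _ v ac ub h))
    (phi_cont _ _ ac ub) phic.
exists xi; first exact: sub xi1.
by split => //; rewrite lt_eqF// (itvP xi1).
Qed.

End Taylor.

(** * Derivatives relative to a closed interval *)

Section DeriveOn.
Variable R : realType.

Lemma limit_point_itvcc (a b v : R) : a < b -> v \in `[a, b] ->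
  limit_point [set` `[a, b]] v.
Proof.
move=> ab; rewrite in_itv/= => /andP[av vb] U /nbhs_ballP[e /= e0 eU].
(* Step half a radius inwards, to the left at [v = b] and to the right elsewhere, truncated at the
   endpoint to stay in [[a, b]]. *)
have [bv|vb'] := leP b v.
  exists (Num.max (v - e / 2) a); split.
  - by rewrite lt_eqF// gt_max; apply/andP; split; lra.
  - by rewrite /= in_itv/= le_max lexx orbT/= ge_max; apply/andP; split; lra.
  - apply: eU; rewrite /ball/= ltr_norml.
    have [?|?] := leP a (v - e / 2); apply/andP; split; lra.
exists (Num.min (v + e / 2) b); split.
- by rewrite gt_eqF// lt_min; apply/andP; split; lra.
- by rewrite /= in_itv/= ge_min lexx orbT andbT le_min; apply/andP; split; lra.
- apply: eU; rewrite /ball/= ltr_norml.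
  have [?|?] := leP b (v + e / 2); apply/andP; split; lra.
Qed.

(** Near [v] the quotient is bounded by [|l| + 1], which gives a Lipschitz estimate at [v]. *)
Lemma continuous_diff_quot (A : set R) (f : R -> R) :
  (forall v, A v -> cvg (diff_quot f v @ within A v^')) ->
  {within A, continuous f}.
Proof.
move=> fA; apply/subspace_continuousP => v Av.
have := fA v Av; set l := lim _ => /cvgrPdist_lt/(_ 1 ltr01) dq1.
have l1 : 0 < `|l| + 1 by rewrite ltr_wpDl.
apply/cvgrPdist_lt => e e0.
move: dq1; rewrite !near_withinE => /nbhs_ballP[d /= d0 dq].
apply/nbhs_ballP; exists (Num.min d (e / (`|l| + 1))) => /=.
  by rewrite lt_min d0 divr_gt0.
move=> z; rewrite /ball/= lt_min => /andP[zd ze] Az.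
have [->|zv] := eqVneq z v; first by rewrite subrr normr0.
have zv0 : z - v != 0 by rewrite subr_eq0.
have := dq z zd zv Az; rewrite /diff_quot => h.
have -> : f v - f z = (f z - f v) / (z - v) * (v - z) by field.
rewrite normrM; set q := (f z - f v) / (z - v) in h *.
have ql : `|q| <= `|l| + 1.
  have -> : q = l - (l - q) by ring.
  by apply: (le_trans (ler_normB _ _)); rewrite lerD2l ltW.
apply: (@le_lt_trans _ _ ((`|l| + 1) * `|v - z|)); first by rewrite ler_wpM2r.
by move: ze; rewrite ltr_pdivlMr// mulrC.
Qed.

(** At an interior point small increments stay in [[a, b]], so the restricted limit is the ordinary
    derivative. *)
Lemma is_derive_derive_on (a b v : R) (f : R -> R) : a < b -> v \in `]a, b[ ->
  cvg (diff_quot f v @ within [set` `[a, b]] v^') ->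
  is_derive v 1 f (derive_on [set` `[a, b]] f v).
Proof.
move=> ab vab; rewrite /derive_on asboolT; last first.
  by apply: limit_point_itvcc => //; exact: subset_itvW vab.
set l := lim _ => cl.
suff L : (fun h => h^-1 *: ((f \o shift v) (h *: 1) - f v)) @ 0^' --> l.
  by split; [apply/cvg_ex; exists l|apply/cvg_lim].
apply/cvgrPdist_lt => e e0; have /cvgrPdist_lt/(_ e e0) := cl.
rewrite !near_withinE => /nbhs_ballP[d /= d0 dq].
move: vab; rewrite in_itv/= => /andP[av vb].
apply/nbhs_ballP; exists (Num.min d (Num.min (v - a) (b - v))) => /=.
  by rewrite !lt_min d0 !subr_gt0 av vb.
move=> h; rewrite /ball/= sub0r normrN !lt_min => /and3P[hd ha hb] h0.
have := dq (h + v); rewrite /diff_quot addrK /GRing.scale/= mulr1 mulrC; apply.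
- by rewrite /ball/= opprD addrCA subrr addr0 normrN.
- by rewrite -subr_eq0 addrK.
- by move: ha hb; rewrite !ltr_norml in_itv/= => /andP[? ?] /andP[? ?]; apply/andP; split; lra.
Qed.

End DeriveOn.

(** * Exponential series estimates and auxiliary bounds *)

(** Since [t^t / t!] is a term of the series of [e^t] and [z <= t / e^2], the quotient is at most
    [e^(-2t) * e^t]. This explains the [e^2] in the lower bound on [t]. *)
Lemma pow_fact_le_expRN (R : realType) (z : R) (t : nat) :
  (0 < t)%N -> 0 <= z -> expR 1 ^+ 2 * z <= t%:R ->
  z ^+ t / t`!%:R <= expR (- t%:R).
Proof.
case: t => // t _ z0 zt.
have tt : t.+1%:R ^+ t.+1 / t.+1`!%:R <= expR t.+1%:R :> R.
  by have := @expR_ge1Dxn R t.+1%:R t (ler0n _ _); lra.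
have -> : expR (- t.+1%:R) = expR t.+1%:R / (expR 1 ^+ 2) ^+ t.+1 :> R.
  by rewrite -!expRM_natr mul1r -expRN -expRD; congr expR; ring.
rewrite ler_pdivlMr ?exprn_gt0 ?expR_gt0//; apply: le_trans tt.
rewrite mulrAC -exprMn ler_pM2r ?invr_gt0 ?ltr0n ?fact_gt0//.
by rewrite lerXn2r ?nnegrE ?mulr_ge0 ?exprn_ge0 ?expR_ge0//; rewrite mulrC.
Qed.

Lemma sum_pow_fact_le_expR (R : realType) (z : R) (n : nat) : 0 <= z ->
  \sum_(s < n) z ^+ s.+1 / s.+1`!%:R <= expR z - 1.
Proof.
move=> z0.
have nd : nondecreasing_seq (series (exp_coeff z)).
  apply/nondecreasing_seqP => k; rewrite seriesSr lerDl.
  by rewrite /exp_coeff/= divr_ge0 ?exprn_ge0.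
have := nondecreasing_cvgn_le nd (is_cvg_series_exp_coeff z) n.+1.
rewrite -/(expR z) seriesEord/= big_ord_recl /exp_coeff/= expr0 fact0 divr1.
by rewrite lerBrDl.
Qed.

Lemma mx_norm_le (R : realDomainType) (m n : nat) (A : 'M[R]_(m, n)) (B : R) :
  0 <= B -> (forall i j, `|A i j| <= B) -> mx_norm A <= B.
Proof. by move=> B0 AB; rewrite mx_normrE; apply: bigmax_le => // -[i j] _. Qed.

Lemma rank_const_mx_le1 (F : fieldType) (m n : nat) (c : F) :
  (\rank (const_mx c : 'M[F]_(m, n)) <= 1)%N.
Proof.
have -> : const_mx c = (\col_i c) *m (\row_j 1) :> 'M[F]_(m, n).
  by apply/matrixP => i j; rewrite !mxE big_ord1 !mxE mulr1.
by rewrite (leq_trans (mxrankM_maxl _ _))// rank_leq_col.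
Qed.

Lemma derive_onn_abs_le (R : realType) (A : set R) (h : R -> R) (C M : R) :
  (forall s, (sup_norm A (derive_onn A s h) <= (C * M ^+ s)%:E)%E) ->
  forall s v, A v -> `|derive_onn A s h v| <= C * M ^+ s.
Proof.
move=> hs s v Av; rewrite -lee_fin; apply: le_trans (hs s).
by apply: ereal_sup_ubound; exists v.
Qed.

(** * Assembly of the Taylor expansion and the sketched powers *)

Theorem corollary4p5 (R : realType)
    (eps : R) (heps : 0 < eps < 1)
    (n1 n2 : nat) (hn1 : (0 < n1)%N) (hn2 : (0 < n2)%N)
    (r : nat) (hr : r%:Z = Num.ceil (9 * ln (3 * n1%:R * n2%:R) / eps ^+ 2))
    (m : nat) (hm : (0 < m)%N)
    (W : 'M[R]_m) (hW : sym_posdef W)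
    (rad : R) (hrad : 0 < rad)
    (x : 'I_n1 -> 'cV[R]_m) (hx : forall i, norm2 (x i) <= rad)
    (y : 'I_n2 -> 'cV[R]_m) (hy : forall j, norm2 (y j) <= rad)
    (D : 'M[R]_(n1, n2)) (hD : forall i j, D i j = wnorm W (x i - y j) ^+ 2)
    (Omega : set R) (hOmega : Omega = [set` `[min_entry D, max_entry D]])
    (h : R -> R)
    (hbounded : [bounded h u | u in Omega])
    (hsmooth : smooth_on Omega h)
    (C M : R) (hC : 0 <= C) (hM : 0 < M)
    (hderiv : forall s : nat,
       (sup_norm Omega (derive_onn Omega s h) <= (C * M ^+ s)%:E)%E)
    (t : nat) (ht0 : (0 < t)%N)
    (ht : expR 1 ^+ 2 * M * (max_entry D - min_entry D) / 2 <= t%:R) :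
  exists G : 'M[R]_(n1, n2),
    (\rank G <= 1 + (t - 1) * r)%N /\
    mx_norm (map_mx h D - G) <=
      C * (expR (- t%:R)
           + eps * (expR (8 * M * spectral_norm W * rad ^+ 2) - 1)).
Proof.
have /andP[eps0 eps1] := heps.
set lo := min_entry D in hOmega ht *; set hi := max_entry D in hOmega ht *.
have [[i0 [j0 loE]] loP] := min_entryP D hn1 hn2.
have [[i1 [j1 hiE]] hiP] := max_entryP D hn1 hn2.
set w := spectral_norm W * rad ^+ 2.
have rad0 := ltW hrad.
have w0 : 0 <= w by rewrite mulr_ge0 ?spectral_norm_ge0 ?sqr_ge0.
have -> : 8 * M * spectral_norm W * rad ^+ 2 = 8 * M * w by rewrite /w mulrA.
have Mw0 : 0 <= 8 * M * w by rewrite mulr_ge0// mulr_ge0// ltW.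
have exp1 : 0 <= expR (8 * M * w) - 1 by have := expR_ge1Dx (8 * M * w); lra.
have rhs0 : 0 <= C * (expR (- t%:R) + eps * (expR (8 * M * w) - 1)).
  by rewrite mulr_ge0// addr_ge0 ?expR_ge0// mulr_ge0// ltW.
have D04 i j : 0 <= D i j <= 4 * w.
  by rewrite hD sqr_ge0 sqr_wnormB_le.
have lohi : lo <= hi by rewrite /hi hiE; exact: loP.
(* If [Omega] is a singleton, [h(D)] is a constant matrix. Otherwise every point of [Omega] is a
   limit point, so the smoothness hypothesis applies there. *)
move: lohi; rewrite le_eqVlt => /orP[/eqP lohi|lohi].
  exists (const_mx (h lo)); split.
    by rewrite (leq_trans (rank_const_mx_le1 _ _ _))// leq_addr.
  apply: mx_norm_le => // i j; rewrite !mxE.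
  have -> : D i j = lo by apply/eqP; rewrite eq_le loP lohi hiP.
  by rewrite subrr normr0.
pose c := (lo + hi) / 2.
have Om v : v \in `[lo, hi] -> Omega v by rewrite hOmega.
have clohi : c \in `[lo, hi] by rewrite in_itv/= /c; apply/andP; split; lra.
have Dlohi i j : D i j \in `[lo, hi] by rewrite in_itv/= loP hiP.
have c04 : 0 <= c <= 4 * w.
  have /andP[] := D04 i0 j0; have /andP[] := D04 i1 j1.
  by rewrite -loE -hiE -/lo -/hi /c => *; apply/andP; split; lra.
pose g s := derive_onn Omega s h.
have gle s v : v \in `[lo, hi] -> `|g s v| <= C * M ^+ s.
  by move=> /Om; exact: derive_onn_abs_le.
have g_cvg s v : v \in `[lo, hi] -> cvg (diff_quot (g s) v @ within Omega v^').
  move=> vI; apply: hsmooth; first exact: Om.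
  by rewrite hOmega; exact: limit_point_itvcc.
have g_cont s : {within `[lo, hi], continuous (g s)}.
  by apply: continuous_diff_quot => v vI; rewrite -hOmega; exact: g_cvg.
have g_derive s v : v \in `]lo, hi[ -> is_derive v 1 (g s) (g s.+1 v).
  move=> vI; rewrite /g /derive_onn iterS -/(derive_onn Omega s h) -/(g s).
  by rewrite hOmega; apply: is_derive_derive_on => //; rewrite -hOmega;
    apply: g_cvg; exact: subset_itvW vI.
have DG : gamma2_le (fun i j => D i j - c) (6 * w).
  by apply: eq_gamma2 (gamma2_sqr_wnormB hW rad0 hx hy c04) => i j; rewrite hD.
(* The accuracy [4/3 * eps] converts the 9 in [r] into the 16 of [gamma2_sketch], as
   [9 * (4/3)^2 = 16]. *)
have hr' : 16 * ln (3 * n1%:R * n2%:R) <= r%:R * (4 / 3 * eps) ^+ 2.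
  have : 9 * ln (3 * n1%:R * n2%:R) / eps ^+ 2 <= r%:R.
    by have := Num.Theory.ceil_ge (9 * ln (3 * n1%:R * n2%:R) / eps ^+ 2); rewrite -hr.
  rewrite ler_pdivrMr ?exprn_gt0// exprMn; lra.
have eta0 : 0 < 4 / 3 * eps by rewrite mulr_gt0.
have /choice[G HG] : forall s : nat, exists G : 'M[R]_(n1, n2), (\rank G <= r)%N /\
    forall i j, `|(D i j - c) ^+ s - G i j| <= 4 / 3 * eps * (6 * w) ^+ s.
  by move=> s; exact: gamma2_sketch eta0 (gamma2X s DG) hr'.
pose k s := g s c / s`!%:R.
(* The zeroth power is the all-ones matrix, kept exactly at rank at most 1; only the powers 1 to
   [t - 1] are sketched. *)
exists (const_mx (k 0) + \sum_(s < t.-1) k s.+1 *: G s.+1); split.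
  rewrite (leq_trans (mxrank_add _ _))// leq_add ?rank_const_mx_le1//.
  rewrite subn1 -[in leqRHS](size_enum_ord t.-1) -big_enum/=.
  apply: mxrank_sum_le => s; rewrite (leq_trans (mxrank_scale _ _))//.
  by have [] := HG s.+1.
apply: mx_norm_le => // i j.
(* The error splits into the Taylor remainder and the weighted sketching errors. *)
have -> : (map_mx h D - (const_mx (k 0) + \sum_(s < t.-1) k s.+1 *: G s.+1)) i j
    = (h (D i j) - \sum_(s < t) k s * (D i j - c) ^+ s)
      + \sum_(s < t.-1) k s.+1 * ((D i j - c) ^+ s.+1 - G s.+1 i j).
  rewrite !mxE summxE -(prednK ht0) big_ord_recl/= expr0 mulr1.
  have -> : \sum_(s < t.-1) (k s.+1 *: G s.+1) i j = \sum_(s < t.-1) k s.+1 * G s.+1 i j.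
    by apply: eq_bigr => s _; rewrite mxE.
  have -> : \sum_(s < t.-1) k s.+1 * ((D i j - c) ^+ s.+1 - G s.+1 i j)
      = \sum_(s < t.-1) k s.+1 * (D i j - c) ^+ s.+1 - \sum_(s < t.-1) k s.+1 * G s.+1 i j.
    by rewrite -sumrB; apply: eq_bigr => s _; rewrite mulrBr.
  ring.
apply: (le_trans (ler_normD _ _)); rewrite mulrDr; apply: lerD.
  have [xi xiI ->] := taylor_Lagrange g_derive g_cont ht0 clohi (Dlohi i j).
  rewrite normrM normrX normrM normfV [`|_`!%:R|]ger0_norm//.
  (* Centering at the midpoint gives [|D i j - c| <= (hi - lo) / 2]. *)
  apply: (@le_trans _ _ (C * ((M * ((hi - lo) / 2)) ^+ t / t`!%:R))); last first.
    rewrite ler_wpM2l// pow_fact_le_expRN//.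
      by rewrite !mulr_ge0 ?subr_ge0 ?ltW.
    by apply: le_trans ht; rewrite !mulrA.
  have -> : C * ((M * ((hi - lo) / 2)) ^+ t / t`!%:R)
      = (C * M ^+ t / t`!%:R) * ((hi - lo) / 2) ^+ t by rewrite exprMn; ring.
  apply: ler_pM; rewrite ?exprn_ge0 ?divr_ge0//.
    by rewrite ler_wpM2r ?invr_ge0// gle.
  rewrite lerXn2r ?nnegrE ?divr_ge0 ?subr_ge0 ?(ltW lohi)//.
  have := Dlohi i j; rewrite in_itv/= ler_norml /c => /andP[? ?].
  by apply/andP; split; lra.
apply: (le_trans (ler_norm_sum _ _ _)).
rewrite mulrA; apply: (@le_trans _ _ (\sum_(s < t.-1) C * eps * ((8 * M * w) ^+ s.+1 / s.+1`!%:R))); last first.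
  by rewrite -mulr_sumr ler_wpM2l ?mulr_ge0 ?(ltW eps0)// sum_pow_fact_le_expR.
apply: ler_sum => s _; rewrite normrM.
have [_ /(_ i j) Gs] := HG s.+1.
have ks : `|k s.+1| <= C * M ^+ s.+1 / s.+1`!%:R.
  by rewrite normrM normfV [`|_`!%:R|]ger0_norm// ler_wpM2r ?invr_ge0// gle.
apply: (le_trans (ler_pM _ _ ks Gs)) => //.
have -> : C * M ^+ s.+1 / s.+1`!%:R * (4 / 3 * eps * (6 * w) ^+ s.+1)
    = C * eps * M ^+ s.+1 / s.+1`!%:R * w ^+ s.+1 * (4 / 3 * 6 ^+ s.+1).
  by rewrite !exprMn; ring.
have -> : C * eps * ((8 * M * w) ^+ s.+1 / s.+1`!%:R)
    = C * eps * M ^+ s.+1 / s.+1`!%:R * w ^+ s.+1 * 8 ^+ s.+1.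
  by rewrite !exprMn; ring.
rewrite ler_wpM2l//.
  by rewrite !mulr_ge0 ?exprn_ge0 ?invr_ge0 ?(ltW eps0) ?(ltW hM).
(* Because the power is at least 1, one factor 6 absorbs the loss: [4/3 * 6 = 8], and [6^s <= 8^s]
   for the rest. *)
rewrite !exprS mulrA; apply: ler_pM => //; first lra.
by rewrite lerXn2r ?nnegrE//; lra.
Qed.
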